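(* Let $D$ be a Prüfer domain and let $X\subseteq\mathrm{Spec}(D)$ be a splitting set of $D$. Then $\mathrm{Inv}_X(D)$ is a convex subgroup of $\mathrm{Inv}(D)$, and there is a group isomorphism $$\frac{\mathrm{Inv}(D)}{\mathrm{Inv}_X(D)}\simeq\mathrm{Inv}(\Omega(X)).$$ If also $X\subseteq\mathrm{Max}(D)$, then $\mathrm{Inv}_X(D)$ is archimedean.
   Context: $K$ is the quotient field of $D$. A fractional ideal of $D$ is a $D$-submodule $I\subseteq K$ with $dI\subseteq D$ for some nonzero $d\in D$ (fractional ideals are taken nonzero). $\mathrm{Inv}(D)$ is the group of invertible fractional ideals under multiplication; for $D$ Prüfer it is an $\ell$-group (lattice-ordered group) when ordered by reverse containment. For $X\subseteq\mathrm{Spec}(D)$, $X^\uparrow:=\{P\in\mathrm{Spec}(D)\mid Q\subseteq P\text{ for some }Q\in X\}$. The inverse topology on $\mathrm{Spec}(D)$ is the topology having as a subbasis of open sets the sets $\mathcal V(I)=\{P\in\mathrm{Spec}(D)\mid I\subseteq P\}$, for $I$ a finitely generated ideal. A subset $X\subseteq\mathrm{Spec}(D)$ is a splitting set if $X=X^\uparrow$ and $X$ is open in the inverse topology (equivalently, $X=X^\uparrow$ and $\mathrm{Spec}(D)\setminus X$ is compact, i.e. quasi-compact, in the Zariski topology). The Nagata transform of $D$ with respect to $X$ is $\Omega(X):=\bigcap\{D_P\mid P\in\mathrm{Spec}(D)\setminus X^\uparrow\}$ (the empty intersection being $K$). The support of a fractional ideal $I$ is $\mathrm{supp}(I):=\{P\in\mathrm{Spec}(D)\mid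 ID_P\neq D_P\}$, and $\mathrm{Inv}_X(D):=\{I\in\mathrm{Inv}(D)\mid\mathrm{supp}(I)\subseteq X\}$. A subgroup $H$ of an ordered group $G$ is convex if $a<b<c$ with $a,c\in H$ implies $b\in H$. An $\ell$-group $G$ (written additively) is archimedean if, whenever $a,b\in G$ satisfy $na\le b$ for all $n\in\mathbb N$, then $a\le 0$. *)

(* Defs.v *)
From HB Require Import structures.
From mathcomp Require Import all_boot all_order all_algebra.
From mathcomp Require Import boolp classical_sets topology_structure.

Set Implicit Arguments.
Unset Strict Implicit.
Unset Printing Implicit Defensive.

Import Order.TTheory GRing.Theory Num.Theory.

Local Open Scope classical_set_scope.
Local Open Scope ring_scope.

Local Notation "x %:F" := (@FracField.tofrac _ x) : ring_scope.

(* Fractional ideals of a subring A of a field K. The group Inv A below is     *)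
(* used for D itself, seen inside K = {fraction D}, and for its overring       *)
(* Omega X. In both cases K is the quotient field of the subring, since every  *)
(* element of K is a quotient of two elements of D.                            *)
Section FractionalIdeals.
Variable K : fieldType.
Implicit Types (I J L S : set K) (A : subringClosed K).

Definition mulI I J : set K :=
  [set z | exists2 s : seq (K * K),
     {in s, forall p, I p.1 /\ J p.2} & z = \sum_(p <- s) p.1 * p.2].

Definition submodule A I : Prop :=
  [/\ I 0, (forall x y, I x -> I y -> I (x + y))
    & (forall a x, a \in A -> I x -> I (a * x))].

Definition fractional_ideal A I : Prop :=
  [/\ submodule A I, (exists2 x, I x & x != 0)
    & exists d, [/\ d \in A, d != 0 & forall x, I x -> d * x \in A]].

Definition invertible_ideal A I : Prop :=
  fractional_ideal A I /\
  exists J, fractional_ideal A J /\ mulI I J = [set x | x \in A].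

Definition colonI A I : set K := [set x | forall y, I y -> x * y \in A].

Lemma mulI_sub I J S :
    S 0 -> (forall x y, S x -> S y -> S (x + y)) ->
    (forall x y, I x -> J y -> S (x * y)) -> mulI I J `<=` S.
Proof.
move=> S0 SD SM _ [s + ->]; elim: s => [|p s IHs] sIJ; first by rewrite big_nil.
rewrite big_cons; apply: SD.
  by have [] := sIJ p (mem_head _ _); apply: SM.
by apply: IHs => q qs; apply: sIJ; rewrite inE qs orbT.
Qed.

Lemma mulI_mul I J x y : I x -> J y -> mulI I J (x * y).
Proof.
move=> Ix Jy; exists [:: (x, y)]; last by rewrite big_seq1.
by move=> p; rewrite inE => /eqP->.
Qed.

Lemma mulI0 I J : mulI I J 0.
Proof. by exists [::] => //; rewrite big_nil. Qed.

Lemma mulID I J x y : mulI I J x -> mulI I J y -> mulI I J (x + y).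
Proof.
move=> [s sP ->] [t tP ->]; exists (s ++ t); last by rewrite big_cat.
by move=> p; rewrite mem_cat => /orP[/sP|/tP].
Qed.

Lemma mulIC : commutative mulI.
Proof.
have sub I J : mulI I J `<=` mulI J I.
  apply: mulI_sub; [exact: mulI0 | exact: mulID |].
  by move=> x y Ix Jy; rewrite mulrC; apply: mulI_mul.
by move=> I J; apply/seteqP; split; apply: sub.
Qed.

Lemma mulIA : associative mulI.
Proof.
have sub I J L : mulI I (mulI J L) `<=` mulI (mulI I J) L.
  apply: mulI_sub; [exact: mulI0 | exact: mulID |].
  move=> x y Ix; move: y.
  apply: (@mulI_sub _ _ [set y | mulI (mulI I J) L (x * y)]) => /=.
  - by rewrite mulr0; apply: mulI0.
  - by move=> y z; rewrite mulrDr; apply: mulID.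
  - by move=> y z Jy Lz; rewrite mulrA; do 2!apply: mulI_mul => //.
move=> I J L; apply/seteqP; split; first exact: sub.
rewrite [mulI (mulI I J) L]mulIC [mulI I J]mulIC.
by rewrite [mulI I (mulI J L)]mulIC [mulI J L]mulIC; apply: sub.
Qed.

Lemma mul1I A I : submodule A I -> mulI [set x | x \in A] I = I.
Proof.
move=> [I0 ID IM]; apply/seteqP; split; first exact: mulI_sub.
by move=> x Ix; rewrite -[x]mul1r; apply: mulI_mul => //=; apply: rpred1.
Qed.

Lemma fractional_ring A : fractional_ideal A [set x | x \in A].
Proof.
split; first split=> /=; [exact: rpred0|exact: rpredD|exact: rpredM| |].
  by exists 1; [apply: rpred1 | apply: oner_neq0].
by exists 1; split; [apply: rpred1 | apply: oner_neq0 | move=> x; rewrite mul1r].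
Qed.

Lemma fractional_mul A I J :
  fractional_ideal A I -> fractional_ideal A J -> fractional_ideal A (mulI I J).
Proof.
move=> [[I0 ID IM] [x Ix x0] [d [dA d0 dI]]].
move=> [[J0 JD JM] [y Jy y0] [e [eA e0 eJ]]].
split; first split.
- exact: mulI0.
- exact: mulID.
- move=> a z aA; move: z; apply: (@mulI_sub _ _ [set z | mulI I J (a * z)]) => /=.
  + by rewrite mulr0; apply: mulI0.
  + by move=> u v; rewrite mulrDr; apply: mulID.
  + by move=> u v Iu Jv; rewrite mulrA; apply: mulI_mul => //; apply: IM.
- by exists (x * y); [apply: mulI_mul | rewrite mulf_neq0].
exists (d * e); split; [exact: rpredM | exact: mulf_neq0 |].
apply: (@mulI_sub _ _ [set z | d * e * z \in A]) => /=.
- by rewrite mulr0 rpred0.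
- by move=> u v ? ?; rewrite mulrDr rpredD.
- by move=> u v Iu Jv; rewrite mulrACA rpredM ?dI ?eJ.
Qed.

Lemma invertible_ring A : invertible_ideal A [set x | x \in A].
Proof.
have frA := fractional_ring A; split=> //; exists [set x | x \in A].
by split=> //; apply: mul1I; case: frA.
Qed.

Lemma invertible_mul A I J :
  invertible_ideal A I -> invertible_ideal A J -> invertible_ideal A (mulI I J).
Proof.
move=> [frI [I' [frI' II']]] [frJ [J' [frJ' JJ']]].
split; first exact: fractional_mul.
exists (mulI J' I'); split; first exact: fractional_mul.
rewrite -mulIA [mulI J _]mulIA JJ' mul1I //.
by case: frI'.
Qed.

Lemma colonI_inv A I J :
  fractional_ideal A J -> mulI I J = [set x | x \in A] -> colonI A I = J.
Proof.
move=> [[J0 JD JM] _ _] IJ; apply/seteqP; split=> x; last first.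
  move=> Jx y Iy; rewrite mulrC.
  by have := mulI_mul Iy Jx; rewrite IJ.
move=> /= xI; have : mulI I J 1 by rewrite IJ /=; apply: rpred1.
rewrite -[x]mulr1; move: (1 : K).
apply: (@mulI_sub _ _ [set z | J (x * z)]) => /=.
- by rewrite mulr0.
- by move=> u v ? ?; rewrite mulrDr; apply: JD.
- by move=> u v Iu Jv; rewrite mulrA; apply: JM => //; apply: xI.
Qed.

Lemma invertible_colon A I : invertible_ideal A I ->
  invertible_ideal A (colonI A I) /\ mulI (colonI A I) I = [set x | x \in A].
Proof.
move=> [frI [J [frJ IJ]]]; rewrite (colonI_inv frJ IJ) mulIC; split=> //.
by split=> //; exists I; rewrite mulIC.
Qed.

Record Inv A := MkInv {
  Inv_set :> set K;
  Inv_subproof : `[< invertible_ideal A Inv_set >] }.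

HB.instance Definition _ A := [isSub for @Inv_set A].
HB.instance Definition _ A := gen_eqMixin (Inv A).
HB.instance Definition _ A := gen_choiceMixin (Inv A).

Section InvGroup.
Variable A : subringClosed K.
Implicit Types a b c : Inv A.

Lemma InvP a : invertible_ideal A a.
Proof. by case: a => I /= /asboolP. Qed.

Definition Inv_zero : Inv A := MkInv (asboolT (invertible_ring A)).
Definition Inv_add a b : Inv A :=
  MkInv (asboolT (invertible_mul (InvP a) (InvP b))).
Definition Inv_opp a : Inv A :=
  MkInv (asboolT (proj1 (invertible_colon (InvP a)))).

Fact Inv_addA : associative Inv_add.
Proof. by move=> a b c; apply: val_inj; apply: mulIA. Qed.
Fact Inv_addC : commutative Inv_add.
Proof. by move=> a b; apply: val_inj; apply: mulIC. Qed.
Fact Inv_add0 : left_id Inv_zero Inv_add.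
Proof.
by move=> a; apply: val_inj; apply: mul1I; case: (InvP a) => -[].
Qed.
Fact Inv_addN : left_inverse Inv_zero Inv_opp Inv_add.
Proof. by move=> a; apply: val_inj; case: (invertible_colon (InvP a)). Qed.

(* The multiplicative group of invertible fractional ideals in additive        *)
(* notation: a + b is the product of ideals, 0 is A and - a is the inverse.    *)
HB.instance Definition _ :=
  GRing.isZmodule.Build (Inv A) Inv_addA Inv_addC Inv_add0 Inv_addN.

Definition Inv_le a b : bool := `[< (b : set K) `<=` a >].

Fact Inv_le_refl : reflexive Inv_le.
Proof. by move=> a; apply/asboolP. Qed.
Fact Inv_le_anti : antisymmetric Inv_le.
Proof.
move=> a b /andP[/asboolP ba /asboolP ab]; apply: val_inj.
by apply/seteqP; split.
Qed.
Fact Inv_le_trans : transitive Inv_le.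
Proof.
move=> b a c /asboolP ba /asboolP cb.
by apply/asboolP; apply: subset_trans ba.
Qed.

HB.instance Definition _ := Order.Le_isPOrder.Build ring_display (Inv A)
  Inv_le_refl Inv_le_anti Inv_le_trans.

End InvGroup.
End FractionalIdeals.

Section OrderedGroups.
Variable G : porderZmodType.

(* porderZmodType carries no compatibility axiom, hence the first clause. *)
Definition lgroup : Prop :=
  [/\ forall a b c : G, a <= b -> a + c <= b + c,
      forall a b : G, exists s, forall c, (s <= c) = (a <= c) && (b <= c)
    & forall a b : G, exists i, forall c, (c <= i) = (c <= a) && (c <= b)].

Definition archimedean_lgroup : Prop :=
  lgroup /\ forall a b : G, (forall n : nat, a *+ n <= b) -> a <= 0.

Definition convex_subgroup (H : {pred G}) : Prop :=
  zmod_closed H /\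
  forall a b c : G, a < b -> b < c -> a \in H -> c \in H -> b \in H.

End OrderedGroups.

Record Spec (D : idomainType) := MkSpec {
  prime_set :> set D;
  prime_ideal : idealr_closed [in prime_set];
  prime_closed : prime_idealr_closed [in prime_set] }.

HB.instance Definition _ (D : idomainType) := gen_eqMixin (Spec D).
HB.instance Definition _ (D : idomainType) := gen_choiceMixin (Spec D).

Section Domain.
Variable D : idomainType.
Local Notation K := {fraction D}.
Implicit Types (P Q : Spec D) (X : set (Spec D)) (I : set D).

Definition fg_ideal I : Prop :=
  exists s : seq D, I = [set \sum_(i < size s) c i * s`_i | c in @setT ('I_(size s) -> D)].

Definition Max : set (Spec D) :=
  [set P | forall J : set D, idealr_closed [in J] -> P `<=` J -> J = P].

Definition upset X : set (Spec D) := [set P | exists2 Q, X Q & Q `<=` P].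

Definition specV I : set (Spec D) := [set P | I `<=` P].

Definition inverse_Spec : Type := Spec D.
HB.instance Definition _ := Choice.on inverse_Spec.
HB.instance Definition _ :=
  @isSubBaseTopological.Build inverse_Spec (set D) fg_ideal specV.

Definition splitting_set X : Prop :=
  X = upset X /\ open (X : set inverse_Spec).

Definition baseD : {pred K} := fun x => `[< exists a : D, x = a%:F >].

Fact baseD_subring : subring_closed baseD.
Proof.
split; first by apply/asboolP; exists 1; rewrite tofrac1.
  move=> _ _ /asboolP[a ->] /asboolP[b ->].
  by apply/asboolP; exists (a - b); rewrite tofracB.
move=> _ _ /asboolP[a ->] /asboolP[b ->].
by apply/asboolP; exists (a * b); rewrite tofracM.
Qed.
HB.instance Definition _ := GRing.isSubringClosed.Build K baseD baseD_subring.

Definition prufer : Prop :=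
  forall I, fg_ideal I -> (exists2 a, I a & a != 0) ->
  invertible_ideal baseD [set a%:F | a in I].

Definition loc P : set K := [set x | exists a s : D, ~ prime_set P s /\ x = a%:F / s%:F].

Lemma loc_neq0 P s : ~ prime_set P s -> s%:F != 0 :> K.
Proof.
apply: contra_notN; rewrite tofrac_eq0 => /eqP->.
by have [/set_mem] := prime_ideal P.
Qed.

Lemma loc_mul P s t :
  ~ prime_set P s -> ~ prime_set P t -> ~ prime_set P (s * t).
Proof.
move=> Ps Pt /mem_set /(@prime_closed _ P) /orP[] /set_mem //.
Qed.

Lemma loc_base P a : loc P a%:F.
Proof.
exists a, 1; split; last by rewrite tofrac1 divr1.
by have [_ /negP + _] := prime_ideal P; apply: contra_not => /mem_set.
Qed.

Lemma locM P x y : loc P x -> loc P y -> loc P (x * y).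
Proof.
move=> [a [s [Ps ->]]] [b [t [Pt ->]]]; exists (a * b), (s * t).
by split; [apply: loc_mul | rewrite !tofracM invfM mulrACA].
Qed.

Lemma locB P x y : loc P x -> loc P y -> loc P (x - y).
Proof.
move=> [a [s [Ps ->]]] [b [t [Pt ->]]]; exists (a * t - b * s), (s * t).
split; first exact: loc_mul.
rewrite tofracB !tofracM -mulNr addf_div ?(loc_neq0 Ps) ?(loc_neq0 Pt) //.
by rewrite mulNr.
Qed.

Lemma loc_submodule P : submodule baseD (loc P).
Proof.
have loc0 : loc P 0 by rewrite -tofrac0; apply: loc_base.
split=> // [x y lx ly|a x /asboolP[b ->]]; last exact/locM/loc_base.
rewrite -[y]opprK; apply: locB => //.
by rewrite -[- y]sub0r; apply: locB.
Qed.

Definition Omega X : {pred K} :=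
  [in \bigcap_(P in ~` upset X) loc P].

Fact Omega_subring X : subring_closed (Omega X).
Proof.
split.
- by apply/mem_set => P _; rewrite -tofrac1; apply: loc_base.
- move=> x y /set_mem xX /set_mem yX; apply/mem_set => P PX.
  by apply: locB; [apply: xX | apply: yX].
- move=> x y /set_mem xX /set_mem yX; apply/mem_set => P PX.
  by apply: locM; [apply: xX | apply: yX].
Qed.
HB.instance Definition _ X :=
  GRing.isSubringClosed.Build K (Omega X) (Omega_subring X).

Definition supp (I : set K) : set (Spec D) :=
  [set P | mulI I (loc P) <> loc P].

Definition InvX X : {pred Inv baseD} :=
  [in [set I : Inv baseD | supp I `<=` X]].

Fact InvX_zmod X : zmod_closed (InvX X).
Proof.
have baseP P : mulI [set x | x \in baseD] (loc P) = loc P.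
  exact/mul1I/loc_submodule.
split; first by apply/mem_set => P /=; rewrite /supp /= baseP.
move=> I J /set_mem IX /set_mem JX; apply/mem_set => P sP.
apply: contrapT => nX; apply: sP => /=.
have IP : mulI I (loc P) = loc P by apply: contrapT => /IX.
have JP : mulI J (loc P) = loc P by apply: contrapT => /JX.
have JVP : mulI (colonI baseD J) (loc P) = loc P.
  by rewrite -{1}JP mulIA (proj2 (invertible_colon (InvP J))).
by rewrite -mulIA JVP.
Qed.
HB.instance Definition _ X :=
  GRing.isZmodClosed.Build (Inv baseD) (InvX X) (InvX_zmod X).

Definition InvXg X : Type := {I : Inv baseD | InvX X I}.
HB.instance Definition _ X := SubChoice.on (InvXg X).
HB.instance Definition _ X := [SubChoice_isSubZmodule of InvXg X by <:].
HB.instance Definition _ X :=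
  [SubChoice_isSubPOrder of InvXg X by <: with ring_display].

End Domain.

Arguments baseD : clear implicits.
Arguments Max : clear implicits.
Arguments prufer : clear implicits.

(* Main.v *)
Require Import Defs.
From HB Require Import structures.
From mathcomp Require Import all_boot all_order all_algebra.
From mathcomp Require Import boolp classical_sets topology_structure.

Set Implicit Arguments.
Unset Strict Implicit.
Unset Printing Implicit Defensive.

Import Order.TTheory GRing.Theory.

(** An invertible ideal is generated by finitely many elements: the left factors
    of an expression of 1 as an element of I J, where J is the inverse of I. In
    a Prüfer domain the converse holds for nonzero fractional ideals. These two
    facts give surjectivity in the isomorphism, and infima in the order.

    Convexity: if I contains J and J contains L, then J D_P lies between L D_P
    and I D_P, so it equals D_P as soon as both of these do.

    Isomorphism: the map I |-> I Omega(X) is a morphism from Inv(D) to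
    Inv(Omega(X)). It is onto because generators over Omega(X) of an invertible
    ideal of Omega(X) also generate an invertible ideal over D. Its kernel is
    Inv_X(D): if I Omega(X) = Omega(X) then I D_P = D_P for P outside X, since
    D_P contains Omega(X); conversely, if the support of I lies in X then both I
    and its inverse lie in the intersection Omega(X) of the D_P with P outside
    X, whence I Omega(X) = Omega(X).

    Lattice order: the sum of two invertible ideals is finitely generated, hence
    invertible, and it is their infimum for reverse containment; suprema follow
    by inversion.

    Archimedean property: let J be contained in every power I^n, and suppose
    that 1 is not in I. Then the inverse of I has an element y outside D, and
    y is outside D_P for some prime P. As D_P is a valuation ring, the elements
    a of D such that a y^n is in D_P for all n form a prime Q strictly below P,
    and J lies in Q because I^n y^n lies in D. Now Q is not maximal, hence not
    in X; if the support of J were contained in X we would get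
    D_Q = J D_Q = Q D_Q, which is absurd. *)

Local Open Scope classical_set_scope.
Local Open Scope ring_scope.

Local Notation "x %:F" := (@FracField.tofrac _ x) : ring_scope.
Local Notation rset A := [set x | x \in A].

(** * Products and finitely generated modules in a field *)

Section Products.
Variable K : fieldType.
Implicit Types (I J L : set K) (A B : subringClosed K).

Lemma mulIS I I' J J' : I `<=` I' -> J `<=` J' -> mulI I J `<=` mulI I' J'.
Proof. by move=> II JJ x [s sIJ ->]; exists s => // p /sIJ[/II ? /JJ ?]. Qed.

Lemma mulIACA : interchange (@mulI K) (@mulI K).
Proof.
move=> I J I' J'; rewrite -!mulIA; congr mulI.
by rewrite !mulIA [mulI J I']mulIC.
Qed.

Lemma submodule_mulI A I : submodule A (mulI (rset A) I).
Proof.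
split=> [||a x aA]; [exact: mulI0 | exact: mulID |].
move: x; apply: (@mulI_sub _ _ _ [set x | mulI (rset A) I (a * x)]) => /=.
- by rewrite mulr0; apply: mulI0.
- by move=> x y; rewrite mulrDr; apply: mulID.
- by move=> x y xA Iy; rewrite mulrA; apply: mulI_mul => //=; apply: rpredM.
Qed.

Lemma submodule_rset A B : {subset A <= B} -> submodule A (rset B).
Proof.
move=> AB; split=> /= [|x y|a x /AB]; [exact: rpred0 | exact: rpredD |].
exact: rpredM.
Qed.

Lemma fractional_ext A B I : {subset A <= B} ->
  fractional_ideal A I -> fractional_ideal B (mulI (rset B) I).
Proof.
move=> AB [[I0 ID IM] [x Ix x0] [d [dA d0 dI]]]; split.
- exact: submodule_mulI.
- exists x => //; rewrite -[x]mul1r; apply: mulI_mul => //=.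
  exact: rpred1.
exists d; split=> //; first exact: AB.
apply: (@mulI_sub _ _ _ [set x | d * x \in B]) => /=.
- by rewrite mulr0 rpred0.
- by move=> u v ? ?; rewrite mulrDr rpredD.
- by move=> u v uB /dI/AB ?; rewrite mulrCA rpredM.
Qed.

Lemma invertible_ext A B I : {subset A <= B} ->
  invertible_ideal A I -> invertible_ideal B (mulI (rset B) I).
Proof.
move=> AB [frI [J [frJ IJ]]]; split; first exact: fractional_ext frI.
exists (mulI (rset B) J); split; first exact: fractional_ext frJ.
rewrite mulIACA IJ mul1I; last exact: submodule_rset.
by rewrite mulIC mul1I //; apply: submodule_rset.
Qed.

(** The inverse of I is J times the inverse of J I. *)
Lemma invertible_factor A I J : fractional_ideal A I -> fractional_ideal A J ->
  invertible_ideal A (mulI J I) -> invertible_ideal A I.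
Proof.
move=> frI frJ [_ [L [frL JIL]]]; split=> //.
exists (mulI J L); split; first exact: fractional_mul.
by rewrite mulIA [mulI I J]mulIC.
Qed.

Definition span A (s : seq K) : set K := mulI (rset A) [set` s].

Lemma span_gen A s x : x \in s -> span A s x.
Proof.
move=> xs; rewrite -[x]mul1r; apply: mulI_mul => //=.
exact: rpred1.
Qed.

Lemma span_sub A s I : submodule A I -> {in s, forall x, I x} -> span A s `<=` I.
Proof. by move=> [I0 ID IM] sI; apply: mulI_sub => // a x aA /sI; apply: IM. Qed.

Lemma span_neq0 A s x : span A s x -> x != 0 -> exists2 y, y \in s & y != 0.
Proof.
move=> sx x0; apply: contrapT => s0; move/negP: x0; apply; apply/eqP.
apply: (@span_sub A s [set 0]) sx.
  by split=> //= [_ _ -> ->|a _ _ ->]; rewrite ?addr0 ?mulr0.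
by move=> y ys /=; apply: contrapT => /eqP y0; apply: s0; exists y.
Qed.

Lemma fractional_span A s : (exists2 x, x \in s & x != 0) ->
  (exists d, [/\ d \in A, d != 0 & {in s, forall x, d * x \in A}]) ->
  fractional_ideal A (span A s).
Proof.
move=> [x xs x0] [d [dA d0 ds]]; split; first exact: submodule_mulI.
  by exists x => //; apply: span_gen.
exists d; split=> //; apply: (@span_sub _ _ [set x | d * x \in A]) => //.
split=> /= [|u v ? ?|a u aA ?].
- by rewrite mulr0 rpred0.
- by rewrite mulrDr rpredD.
- by rewrite mulrCA rpredM.
Qed.

Lemma span_scale A d s :
  mulI (span A [:: d]) (span A s) = span A [seq d * x | x <- s].
Proof.
apply/seteqP; split; last first.
  apply: span_sub; first by rewrite /span -mulIA; apply: submodule_mulI.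
  move=> _ /mapP[x xs ->]; apply: mulI_mul; apply: span_gen => //.
  exact: mem_head.
have [S0 SD SM] := submodule_mulI A [set` [seq d * x | x <- s]].
apply: mulI_sub => // x y dx sy.
apply: (@span_sub A s [set y | span A _ (x * y)]) sy.
  split=> /= [|u v ? ?|a u aA ?]; first by rewrite mulr0.
    by rewrite mulrDr; apply: SD.
  by rewrite mulrCA; apply: SM.
move=> z zs /=; apply: (@span_sub A [:: d] [set x | span A _ (x * z)]) dx.
  split=> /= [|u v ? ?|a u aA ?]; first by rewrite mul0r.
    by rewrite mulrDl; apply: SD.
  by rewrite -mulrA; apply: SM.
by move=> _ /[!inE] /eqP->; apply: span_gen; apply: map_f.
Qed.

(** If 1 is the sum of the products p.1 * p.2, then each x in I is the sum of the
    (x * p.2) * p.1, whose coefficients x * p.2 lie in I J = A. *)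
Lemma invertible_span A I : invertible_ideal A I -> exists s, I = span A s.
Proof.
move=> [[subI _ _] [J [_ IJ]]]; have : mulI I J 1 by rewrite IJ /= rpred1.
move=> [s sIJ e]; exists [seq p.1 | p <- s]; apply/seteqP; split=> [x Ix|].
  exists [seq (x * p.2, p.1) | p <- s].
    move=> _ /mapP[p ps ->] /=; split; last exact: map_f.
    have [_ Jp] := sIJ p ps.
    by have := mulI_mul Ix Jp; rewrite IJ.
  rewrite big_map -[x]mulr1 {1}e mulr_sumr; apply: eq_bigr => p _ /=.
  by rewrite mulr1 mulrAC mulrA.
by apply: span_sub => // _ /mapP[p /sIJ[Ip _] ->].
Qed.

End Products.

(** * Finitely generated ideals and localizations of a Prüfer domain *)

Section Prufer.
Variable D : idomainType.
Local Notation K := {fraction D}.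
Implicit Types (P : Spec D) (X : set (Spec D)).

Lemma fraction_quotient (x : K) : exists a b : D, b != 0 /\ x = a%:F / b%:F.
Proof.
elim/quotW: x => r; exists r.1, r.2; split; first exact: denom_ratioP.
have d0 : r.2%:F != 0 :> K by rewrite tofrac_eq0 denom_ratioP.
suff <- : (\pi_K r)%qT * r.2%:F = r.1%:F by rewrite mulfK.
unlock FracField.tofrac; rewrite -[LHS]FracField.pi_mul.
apply/eqmodP; rewrite /= FracField.equivfE /FracField.mulf.
by rewrite !numden_Ratio ?mulf_neq0 ?oner_neq0 ?denom_ratioP // !mulr1 mulrC.
Qed.

Lemma common_denominator (s : seq K) :
  exists2 d : D, d != 0 &
    exists t : seq D, [seq d%:F * x | x <- s] = map (@FracField.tofrac D) t.
Proof.
elim: s => [|x s [d d0 [t ds]]]; first by exists 1; [exact: oner_neq0 | exists [::]].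
have [a [b [b0 ->]]] := fraction_quotient x.
exists (b * d); first exact: mulf_neq0.
exists (d * a :: [seq b * c | c <- t]) => /=; congr cons.
  by rewrite !tofracM [b%:F * _]mulrC -mulrA [b%:F * _]mulrC mulfVK ?tofrac_eq0.
rewrite -map_comp (eq_map (g := *%R b%:F \o *%R d%:F)); last first.
  by move=> y /=; rewrite tofracM mulrA.
rewrite map_comp ds -map_comp; apply: eq_map => c /=.
by rewrite tofracM.
Qed.

Lemma base_tofrac (a : D) : a%:F \in baseD D.
Proof. by apply/asboolP; exists a. Qed.

Lemma span_fg_ideal (t : seq D) :
  [set a%:F | a in
    [set \sum_(i < size t) c i * t`_i | c in [set: 'I_(size t) -> D]]]
  = span (baseD D) (map (@FracField.tofrac D) t).
Proof.
apply/seteqP; split=> [_ [_ [c _ <-] <-]|].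
  have [S0 SD SM] :=
    submodule_mulI (baseD D) [set` map (@FracField.tofrac D) t].
  rewrite rmorph_sum /=; elim/big_ind: _ => // i _; rewrite tofracM.
  apply: SM; first exact: base_tofrac.
  by apply: span_gen; apply/map_f/mem_nth.
apply: span_sub => [|_ /mapP[a /(nthP 0)[i it <-] ->]].
  split=> [|_ _ [_ [c _ <-] <-] [_ [e _ <-] <-]|_ _ /asboolP[d ->] [_ [c _ <-] <-]].
  - exists 0; rewrite ?tofrac0 //; exists (fun=> 0) => //.
    by rewrite big1 // => i _; rewrite mul0r.
  - exists (\sum_(i < size t) (c i + e i) * t`_i); first by exists (fun i => c i + e i).
    by rewrite -tofracD -big_split; congr _%:F; apply: eq_bigr => i _; rewrite mulrDl.
  - exists (\sum_(i < size t) (d * c i) * t`_i); first by exists (fun i => d * c i).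
    by rewrite -tofracM mulr_sumr; congr _%:F; apply: eq_bigr => j _; rewrite mulrA.
exists t`_i => //; exists (fun j => (j == Ordinal it)%:R) => //.
rewrite (bigD1 (Ordinal it)) //= eqxx mul1r big1 ?addr0 // => j /negPf ->.
by rewrite mul0r.
Qed.

(** The defining property of Prüfer domains concerns ideals contained in D;
    clearing denominators multiplies by a principal ideal, which leaves
    invertibility unchanged. *)
Lemma prufer_span (s : seq K) : prufer D -> (exists2 x, x \in s & x != 0) ->
  invertible_ideal (baseD D) (span (baseD D) s).
Proof.
move=> prD [x xs x0]; have [d d0 [t dst]] := common_denominator s.
have dF0 : d%:F != 0 :> K by rewrite tofrac_eq0.
apply: (@invertible_factor _ _ _ (span (baseD D) [:: d%:F])).
- apply: fractional_span; first by exists x.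
  exists d%:F; split=> // [|y ys]; first exact: base_tofrac.
  have : d%:F * y \in map (@FracField.tofrac D) t by rewrite -dst; apply: map_f.
  by case/mapP=> a _ ->; apply: base_tofrac.
- apply: fractional_span; first by exists d%:F; rewrite ?mem_head.
  exists 1; split=> [||y]; [exact: rpred1 | exact: oner_neq0 |].
  by rewrite mem_seq1 mul1r => /eqP ->; apply: base_tofrac.
rewrite span_scale dst -span_fg_ideal; apply: prD; first by exists t.
have : d%:F * x \in map (@FracField.tofrac D) t by rewrite -dst; apply: map_f.
case/mapP=> a ta e.
have : span (baseD D) (map (@FracField.tofrac D) t) a%:F.
  by apply: span_gen; apply: map_f.
rewrite -span_fg_ideal => -[a' Ia' /eqP]; rewrite tofrac_eq => /eqP ea.
exists a; first by rewrite -ea.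
by rewrite -tofrac_eq0 -e mulf_neq0.
Qed.

(** Let J be the inverse of (x, 1) and write 1 = x j + k with j, k in J, so that j,
    k, x j and x k are all in D. The prime P does not contain both x j and k:
    if it misses k then x = (x k) / k is in D_P, otherwise it misses x j and
    x^-1 = j / (x j) is in D_P. *)
Lemma loc_valuation P (x : K) : prufer D -> loc P x \/ loc P x^-1.
Proof.
move=> prD.
have [] := @prufer_span [:: x; 1] prD.
  by exists 1; [rewrite !inE eqxx orbT | exact: oner_neq0].
move=> _ [J [[[J0 JD JM] _ _] IJ]].
have memD y j : y \in [:: x; 1] -> J j -> y * j \in baseD D.
  move=> ys Jj; have := mulI_mul (span_gen (baseD D) ys) Jj.
  by rewrite IJ.
have : mulI (span (baseD D) [:: x; 1]) J 1 by rewrite IJ /= rpred1.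
rewrite /span mulIC mulIA [mulI J _]mulIC mul1I // mulIC.
have S : mulI [set` [:: x; 1]] J `<=`
    [set z | exists j k, [/\ J j, J k & z = x * j + k]].
  apply: mulI_sub => [|_ _ [j [k [Jj Jk ->]]] [j' [k' [Jj' Jk' ->]]]|y j].
  - by exists 0, 0; split=> //; rewrite mulr0 addr0.
  - exists (j + j'), (k + k'); split; [exact: JD | exact: JD |].
    by rewrite mulrDr addrACA.
  rewrite /= !inE => /orP[] /eqP -> Jj.
    by exists j, 0; rewrite addr0.
  by exists 0, j; rewrite mulr0 add0r mul1r.
move=> /S[j [k [Jj Jk e]]].
have /asboolP[a ea] : x * j \in baseD D by rewrite memD // mem_head.
have /asboolP[b eb] : j \in baseD D by rewrite -[j]mul1r memD // !inE eqxx orbT.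
have /asboolP[c ec] : x * k \in baseD D by rewrite memD // mem_head.
have /asboolP[d ed] : k \in baseD D by rewrite -[k]mul1r memD // !inE eqxx orbT.
have ad1 : a + d = 1 by apply/eqP; rewrite -tofrac_eq tofracD -ea -ed -e tofrac1.
have [Pd|Pd] := pselect (prime_set P d); [right|left].
  have Pa : ~ prime_set P a.
    move=> Pa; have [_ /negP + PD] := prime_ideal P; apply.
    rewrite -ad1 -[a]mul1r; apply: PD; exact/mem_set.
  exists b, a; split=> //; rewrite -ea -eb.
  have a0 := loc_neq0 Pa; rewrite -ea mulf_eq0 negb_or in a0.
  by case/andP: a0 => x0 j0; rewrite invfM mulrC mulfVK.
exists c, d; split=> //; have d0 := loc_neq0 Pd.
by rewrite -ec ed mulfK.
Qed.

Lemma idealr_closedP (J : set D) : idealr_closed [in J] <->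
  [/\ J 0, ~ J 1 & forall a u v, J u -> J v -> J (a * u + v)].
Proof.
split=> [[/set_mem J0 /negP J1 JD]|[J0 J1 JD]]; split=> //.
- by move=> /mem_set.
- by move=> a u v /mem_set Ju /mem_set Jv; apply/set_mem/JD.
- exact/mem_set.
- by apply/negP => /set_mem.
- by move=> a u v /set_mem Ju /set_mem Jv; apply/mem_set/JD.
Qed.

Lemma prime_above (J : set D) : idealr_closed [in J] ->
  exists P : Spec D, J `<=` P.
Proof.
move=> idJ.
(* Zorn's lemma also ranges over the empty chain, whose union is the empty set;
   adjoining J to each set makes that case harmless. *)
have [|A [idA maxA]] := @Zorn_bigcup D [set A | idealr_closed [in J `|` A]].
  move=> F Fid Ftot; have /idealr_closedP[J0 J1 JD] := idJ.
  apply/idealr_closedP; split.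
  - by left.
  - case=> // -[A /[dup] FA /Fid /idealr_closedP[_ + _]] A1; apply; by right.
  have key A a u v : F A -> (J `|` A) u -> (J `|` A) v ->
      (J `|` \bigcup_(B in F) B) (a * u + v).
    move=> FA Au Av; have /idealr_closedP[_ _ /(_ a u v Au Av)] := Fid _ FA.
    by case=> ?; [left | right; exists A].
  move=> a u v [Ju|[A FA Au]] [Jv|[B FB Bv]].
  + by left; apply: JD.
  + by apply: (key B) => //; [left | right].
  + by apply: (key A) => //; [right | left].
  have [AB|BA] := Ftot _ _ FA FB.
    by apply: (key B) => //; right => //; apply: AB.
  by apply: (key A) => //; right => //; apply: BA.
have /idealr_closedP[M0 M1 MD] := idA; set M := J `|` A in idA M0 M1 MD.
have Mprime : prime_idealr_closed [in M].
  move=> u v /set_mem Muv; apply: contraT => /norP[/negP Mu /negP Mv].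
  (* B is the ideal generated by M and u; by maximality of M it contains 1, and
     multiplying by v shows that v is in M. *)
  pose B := [set z | exists m d, M m /\ z = d * u + m].
  suff: False by [].
  have MB : M `<=` B by move=> m Mm; exists m, 0; rewrite mul0r add0r.
  have Bu : B u by exists 0, 1; rewrite mul1r addr0.
  have := maxA B; apply.
    split=> [z Az|BA]; first by apply: MB; right.
    by apply/Mu/mem_set; right; apply: BA.
  have JBB : J `|` B = B by apply/setUidPr => z Jz; apply: MB; left.
  rewrite /= JBB; apply/idealr_closedP; split; first exact: MB.
    move=> [m [d [Mm e]]]; apply/Mv/mem_set.
    have -> : v = d * (u * v) + v * m.
      by rewrite mulrA -[LHS]mul1r e mulrDl [m * v]mulrC.
    by apply: (MD) => //; rewrite -[v * m]addr0; apply: MD.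
  move=> a _ _ [m [d [Mm ->]]] [n [e [Mn ->]]].
  exists (a * m + n), (a * d + e); split; first exact: MD.
  by rewrite mulrDr mulrDl mulrA addrACA.
by exists (MkSpec idA Mprime) => x Jx; left.
Qed.

(** The denominators of y form an ideal, which is proper when y is not in D; a
    prime P containing it leaves y no denominator outside P. *)
Lemma loc_bigcap (y : K) : y \notin baseD D -> exists P : Spec D, ~ loc P y.
Proof.
move=> yD; pose J := [set d : D | d%:F * y \in baseD D].
have [|P JP] := @prime_above J.
  apply/idealr_closedP; rewrite /J; split=> /=.
  - by rewrite tofrac0 mul0r rpred0.
  - by rewrite tofrac1 mul1r; apply/negP.
  move=> a u v Ju Jv; rewrite tofracD tofracM mulrDl -mulrA.
  by rewrite rpredD // rpredM // base_tofrac.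
exists P => -[a [s [Ps e]]]; apply/Ps/JP.
by rewrite /J /= e mulrC mulfVK ?(loc_neq0 Ps) // base_tofrac.
Qed.

End Prufer.

(** * Extension of invertible ideals to the Nagata transform *)

Section Localizations.
Variable D : idomainType.
Local Notation K := {fraction D}.
Implicit Types (P : Spec D) (X : set (Spec D)).

Lemma InvXP X (I : Inv (baseD D)) :
  I \in InvX X <-> forall P, ~ X P -> mulI I (loc P) = loc P.
Proof.
split=> [/set_mem IX P PX|IX]; first by apply: contrapT => /IX.
by apply/mem_set => P /=; apply: contra_notP; apply: IX.
Qed.

Lemma sub_mulI_loc P (I : set K) : I `<=` mulI I (loc P).
Proof.
by move=> x Ix; rewrite -[x]mulr1 -tofrac1; apply: mulI_mul => //; apply: loc_base.
Qed.

Lemma Inv_leP (A : subringClosed K) (I J : Inv A) :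
  reflect ((J : set K) `<=` I) (I <= J).
Proof. exact: asboolP. Qed.

Lemma InvX_squeeze X (I J L : Inv (baseD D)) :
  I <= J -> J <= L -> I \in InvX X -> L \in InvX X -> J \in InvX X.
Proof.
move=> /Inv_leP JI /Inv_leP LJ /InvXP IX /InvXP LX; apply/InvXP => P PX.
apply/seteqP; split; first by rewrite -{2}(IX P PX); apply: mulIS.
by rewrite -{1}(LX P PX); apply: mulIS.
Qed.

Section NagataTransform.
Variables (X : set (Spec D)) (upX : X = upset X).

Lemma base_sub_Omega : {subset baseD D <= Omega X}.
Proof. by move=> _ /asboolP[a ->]; apply/mem_set => P _; apply: loc_base. Qed.

Lemma Omega_loc P : ~ X P -> mulI (rset (Omega X)) (loc P) = loc P.
Proof.
move=> PX; apply: mul1I; have [l0 lD _] := loc_submodule P.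
by split=> // a x /set_mem aX; apply: locM; apply: aX; rewrite /= -upX.
Qed.

Definition Inv_Omega (I : Inv (baseD D)) : Inv (Omega X) :=
  MkInv (asboolT (invertible_ext base_sub_Omega (InvP I))).

Lemma Inv_OmegaD I J : Inv_Omega (I + J) = Inv_Omega I + Inv_Omega J.
Proof.
apply: val_inj; rewrite /= /GRing.add /= mulIACA.
by rewrite [mulI (rset (Omega X)) (rset _)]mul1I //; apply: submodule_rset.
Qed.

(** An ideal supported in X lies in every D_P with P outside X, hence in Omega X;
    applied to I and to its inverse, this gives both inclusions between
    I Omega(X) and Omega(X). *)
Lemma Inv_Omega_eq0 I : Inv_Omega I = 0 <-> I \in InvX X.
Proof.
split=> [/(congr1 val) /= e|IX].
  apply/InvXP => P PX.
  by rewrite -(Omega_loc PX) mulIA [mulI I _]mulIC e.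
have sub J : J \in InvX X -> (J : set K) `<=` rset (Omega X).
  move=> /InvXP JX x Jx; apply/mem_set => P /=; rewrite -upX => PX.
  by rewrite -(JX P PX); apply: sub_mulI_loc.
have mulO J : J \in InvX X -> mulI (rset (Omega X)) J `<=` rset (Omega X).
  move=> JX; apply: mulI_sub => /= [|x y|x y xO /(sub _ JX)].
  - exact: rpred0.
  - exact: rpredD.
  - exact: rpredM.
apply: val_inj; apply/seteqP; split; first exact: mulO.
have OD : mulI (rset (Omega X)) (rset (baseD D)) = rset (Omega X).
  by rewrite mulIC mul1I //; apply/submodule_rset/base_sub_Omega.
have [_ II] := invertible_colon (InvP I).
change (rset (Omega X) `<=` mulI (rset (Omega X)) I).
rewrite -{1}OD -II mulIA; apply: mulIS => //.
by apply: (mulO (- I)); rewrite rpredN.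
Qed.

(** Generators over the Nagata transform generate an ideal over D with the same
    extension. *)
Lemma Inv_Omega_surj (prD : prufer D) (J : Inv (Omega X)) :
  exists I, Inv_Omega I = J.
Proof.
have [[_ [x Jx x0] _] _] := InvP J.
have [s eJ] := invertible_span (InvP J).
have sI : invertible_ideal (baseD D) (span (baseD D) s).
  by apply: prufer_span => //; rewrite eJ in Jx; apply: span_neq0 Jx x0.
exists (MkInv (asboolT sI)); apply: val_inj; rewrite /= eJ /span mulIA.
rewrite [mulI (rset (Omega X)) (rset (baseD D))]mulIC.
by rewrite (mul1I (submodule_rset base_sub_Omega)) //.
Qed.

End NagataTransform.

(** * Invertible ideals with bounded powers *)

(** With V = D_P, these are the elements of D lying in all the ideals y^-n V of the
    valuation ring V. They form a prime because the complement of a valuation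
    ring is closed under multiplication: if u y^m and v y^n are not in V,
    neither is their product. The inclusion in P is strict because the numerator
    c of y^-1 = c / s is in P, while c y^2 = s y is not in V. *)
Lemma prime_below P (y : K) : prufer D -> ~ loc P y ->
  exists2 Q : Spec D, Q `<=` P /\ ~ P `<=` Q &
    forall a, prime_set Q a <-> forall n, loc P (a%:F * y ^+ n).
Proof.
move=> prD Py; have [l0 lD lM] := loc_submodule P.
pose q := [set a : D | forall n, loc P (a%:F * y ^+ n)].
have idq : idealr_closed [in q].
  apply/idealr_closedP; split=> [n||a u v qu qv n].
  - by rewrite tofrac0 mul0r.
  - by move/(_ 1%N); rewrite tofrac1 mul1r.
  rewrite tofracD tofracM mulrDl -mulrA; apply: lD => //.
  by apply: lM => //; apply: base_tofrac.
have prq : prime_idealr_closed [in q].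
  move=> u v /set_mem quv; apply: contraT => /norP[/negP qu /negP qv].
  have /existsNP[m um] : ~ q u by move=> /mem_set.
  have /existsNP[n vn] : ~ q v by move=> /mem_set.
  suff: loc P (v%:F * y ^+ n) by [].
  have um0 : u%:F * y ^+ m != 0 by apply: contra_notN um => /eqP->.
  have [|uV] := loc_valuation P (u%:F * y ^+ m) prD; first by [].
  have -> : v%:F * y ^+ n = (u%:F * y ^+ m)^-1 * ((u * v)%:F * y ^+ (m + n)).
    by apply: (mulfI um0); rewrite mulVKf // tofracM exprD mulrACA.
  exact: locM.
exists (MkSpec idq prq) => //=; split=> [x qx|Pq].
  apply: contrapT => Px; apply: Py.
  have [a [s [Ps e]]] := qx 1%N; exists a, (s * x); split; first exact: loc_mul.
  have x0 := loc_neq0 Px.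
  by rewrite tofracM invfM mulrA -e expr1 mulrAC mulfV // mul1r.
have y0 : y != 0 by apply: contra_notN Py => /eqP->.
have [//|[c [s [Ps e]]]] := loc_valuation P y prD.
have c0 : c%:F != 0 :> K.
  by apply: contraNneq y0 => c0; rewrite -invr_eq0 e c0 mul0r.
have Pc : prime_set P c.
  by apply: contrapT => Pc; apply: Py; exists s, c; rewrite -[y]invrK e invf_div.
have := Pq c Pc 2%N => -[b [t [Pt e']]]; apply: Py.
have s0 := loc_neq0 Ps.
exists b, (t * s); split; first exact: loc_mul.
have -> : y = c%:F * y ^+ 2 / s%:F.
  have -> : c%:F = s%:F / y by rewrite e mulrCA mulfV ?mulr1.
  by rewrite expr2 mulrA mulfVK // mulrAC mulfV // mul1r.
by rewrite e' tofracM invfM mulrA.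
Qed.

Lemma Inv_mulrn_loc (I : Inv (baseD D)) (y : K) n x :
  colonI (baseD D) I y -> Inv_set (I *+ n) x -> x * y ^+ n \in baseD D.
Proof.
move=> Iy; elim: n x => [|n IHn] x; first by rewrite mulr1.
rewrite mulrS; move: x.
apply: (@mulI_sub _ _ _ [set x | x * y ^+ n.+1 \in baseD D]) => /= [|u v ? ?|u v Iu Iv].
- by rewrite mul0r rpred0.
- by rewrite mulrDl rpredD.
by rewrite exprS mulrACA rpredM ?IHn // mulrC Iy.
Qed.

Lemma Inv_le0 (I : Inv (baseD D)) : colonI (baseD D) I `<=` rset (baseD D) -> I <= 0.
Proof.
move=> II; apply/Inv_leP; have [_ /= <-] := invertible_colon (InvP I).
have [[[I0 ID IM] _ _] _] := InvP I.
by apply: mulI_sub => // x y /II; apply: IM.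
Qed.

(** The prime Q of prime_below is not maximal, hence outside X, so J D_Q = D_Q;
    but J lies in Q. *)
Lemma Inv_archimedean X (I J : Inv (baseD D)) : prufer D -> X `<=` Max D ->
  J \in InvX X -> (forall n, I *+ n <= J) -> I <= 0.
Proof.
move=> prD XM /InvXP JX IJ; apply: Inv_le0 => y Iy; apply: contrapT => /negP yD.
have [P Py] := loc_bigcap yD.
have [Q [QP nPQ] QE] := prime_below prD Py.
have XQ : ~ X Q by move=> /XM /(_ P (prime_ideal P) QP) PQ; apply: nPQ; rewrite PQ.
have JQ x : Inv_set J x -> exists2 a, prime_set Q a & x = a%:F.
  move=> Jx; have /asboolP[a ea] : x \in baseD D.
    by have /Inv_leP /(_ x Jx) := IJ 0%N.
  exists a => //; apply/QE => n; rewrite -ea.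
  have /Inv_leP /(_ x Jx) In := IJ n.
  by have /asboolP[b ->] := Inv_mulrn_loc Iy In; apply: loc_base.
have /idealr_closedP[Q0 Q1 QD] := prime_ideal Q.
have QM a u : prime_set Q u -> prime_set Q (a * u).
  by move=> Qu; rewrite -[a * u]addr0; apply: QD.
have : loc Q 1 by rewrite -tofrac1; apply: loc_base.
rewrite -(JX Q XQ).
pose QlocQ : set K := [set z | exists q s,
  [/\ prime_set Q q, ~ prime_set Q s & z = q%:F / s%:F]].
have sub : mulI J (loc Q) `<=` QlocQ.
  apply: mulI_sub.
  - by exists 0, 1; rewrite tofrac0 mul0r.
  - move=> _ _ [q [s [Qq Qs ->]]] [r [t [Qr Qt ->]]].
    exists (t * q + s * r), (s * t); split; [exact/QD/QM | exact: loc_mul |].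
    rewrite addf_div ?(loc_neq0 Qs) ?(loc_neq0 Qt) // tofracD !tofracM.
    by rewrite [t%:F * _]mulrC [s%:F * r%:F]mulrC.
  move=> x z /JQ[q Qq ->] [a [s [Qs ->]]]; exists (a * q), s; split=> //.
    exact: QM.
  by rewrite tofracM mulrA [q%:F * _]mulrC.
move=> /sub[q [s [Qq Qs]]] /esym/eqP; have s0 := loc_neq0 Qs.
rewrite -(inj_eq (mulIf s0)) mulfVK // mul1r tofrac_eq => /eqP qs.
by rewrite qs in Qq.
Qed.

End Localizations.

(** * The ordered group of invertible ideals supported in X *)

(** Inversion reverses the order, so it turns infima into suprema. *)
Lemma lgroup_of_meets (G : porderZmodType) :
  (forall a b c : G, a <= b -> a + c <= b + c) ->
  (forall a b : G, exists i, forall c, (c <= i) = (c <= a) && (c <= b)) ->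
  lgroup G.
Proof.
move=> leD meet.
have leN (a b : G) : a <= b -> - b <= - a.
  by move=> /(leD _ _ (- a - b)); rewrite addrA subrr add0r addrC subrK.
have leN2 (a b : G) : (- a <= - b) = (b <= a).
  by apply/idP/idP => /leN //; rewrite !opprK.
split=> // a b; have [i iP] := meet (- a) (- b); exists (- i) => c.
by rewrite -{1}[c]opprK leN2 iP !leN2.
Qed.

Section OrderedInvX.
Variables (D : idomainType) (X : set (Spec D)).

Lemma Inv_leD (A : subringClosed {fraction D}) (I J L : Inv A) :
  I <= J -> I + L <= J + L.
Proof. by move=> /Inv_leP JI; apply/Inv_leP/mulIS. Qed.

(** The infimum is the ideal generated by generators of I and J together. *)
Lemma InvX_meet (prD : prufer D) (I J : Inv (baseD D)) :
  I \in InvX X -> J \in InvX X ->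
  exists2 M, M \in InvX X & forall L, (L <= M) = (L <= I) && (L <= J).
Proof.
move=> /InvXP IX /InvXP JX.
have [[subI [x Ix x0] _] _] := InvP I; have [[subJ _ _] _] := InvP J.
have [s eI] := invertible_span (InvP I); have [t eJ] := invertible_span (InvP J).
have stI : invertible_ideal (baseD D) (span (baseD D) (s ++ t)).
  apply: prufer_span => //; rewrite eI in Ix.
  by have [y ys y0] := span_neq0 Ix x0; exists y => //; rewrite mem_cat ys.
have sub L : submodule (baseD D) L -> (I : set _) `<=` L -> (J : set _) `<=` L ->
    span (baseD D) (s ++ t) `<=` L.
  move=> subL IL JL; apply: span_sub => // y; rewrite mem_cat => /orP[ys|yt].
    by apply: IL; rewrite eI; apply: span_gen.
  by apply: JL; rewrite eJ; apply: span_gen.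
have IM : (I : set _) `<=` span (baseD D) (s ++ t).
  rewrite eI; apply: span_sub => [|y ys]; first exact: submodule_mulI.
  by apply: span_gen; rewrite mem_cat ys.
have JM : (J : set _) `<=` span (baseD D) (s ++ t).
  rewrite eJ; apply: span_sub => [|y yt]; first exact: submodule_mulI.
  by apply: span_gen; rewrite mem_cat yt orbT.
exists (MkInv (asboolT stI)) => [|L].
  apply/InvXP => P PX /=; apply/seteqP; split.
    have [l0 lD _] := loc_submodule P.
    apply: mulI_sub => // y z my lz; apply: locM lz; move: y my.
    apply: sub; first exact: loc_submodule.
      by rewrite -(IX P PX); apply: sub_mulI_loc.
    by rewrite -(JX P PX); apply: sub_mulI_loc.
  by rewrite -{1}(IX P PX); apply: mulIS.
apply/Inv_leP/andP => /= [ML|[/Inv_leP IL /Inv_leP JL]].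
  by split; apply/Inv_leP; [apply: subset_trans IM _ | apply: subset_trans JM _].
by have [[subL _ _] _] := InvP L; apply: sub.
Qed.

Lemma InvXg_lgroup (prD : prufer D) : lgroup (InvXg X).
Proof.
apply: lgroup_of_meets => [I J L|[I IX] [J JX]].
  by rewrite -!Order.le_val !raddfD; apply: Inv_leD.
have [M MX MP] := InvX_meet prD IX JX.
by exists (exist _ M MX) => L; rewrite -!Order.le_val MP.
Qed.

Lemma InvXg_archimedean : prufer D -> X `<=` Max D -> archimedean_lgroup (InvXg X).
Proof.
move=> prD XM; split=> [|I J IJ]; first exact: InvXg_lgroup.
rewrite -Order.le_val raddf0.
apply: (@Inv_archimedean _ X (val I) (val J)) => // [|n]; first exact: (valP J).
by rewrite -raddfMn Order.le_val.
Qed.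

Lemma quotient_InvX_iso : prufer D -> X = upset X ->
  exists f : {additive Quotient.quot (InvX X) -> Inv (Omega X)}, bijective f.
Proof.
move=> prD upX; pose phi := Inv_Omega X.
have phi_zmod : zmod_morphism phi.
  by move=> I J; apply: (addIr (phi J)); rewrite -Inv_OmegaD !subrK.
pose f (q : Quotient.quot (InvX X)) := phi (repr q).
have f_pi I : f (\pi_(Quotient.quot (InvX X)) I)%qT = phi I.
  apply/subr0_eq; rewrite -phi_zmod; apply/(Inv_Omega_eq0 upX).
  have /eqP := reprK (\pi_(Quotient.quot (InvX X)) I)%qT.
  by rewrite -Quotient.idealrBE.
have f_zmod : zmod_morphism f.
  move=> p q; rewrite -[p in LHS]reprK -[q in LHS]reprK.
  by rewrite -[in LHS]raddfB f_pi phi_zmod.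
pose fA := GRing.isZmodMorphism.Build _ _ f f_zmod.
pose fM : {additive Quotient.quot (InvX X) -> Inv (Omega X)} := HB.pack f fA.
have surj J : {q | f q = J}.
  apply: cid; have [I <-] := Inv_Omega_surj prD J.
  by exists (\pi_(Quotient.quot (InvX X)) I)%qT.
exists fM; exists (fun J => sval (surj J)) => [q|J]; last exact: (svalP (surj J)).
case: (surj _) => q' /= fq; rewrite -[q]reprK -[q']reprK; apply/eqP.
rewrite -Quotient.idealrBE; apply/(Inv_Omega_eq0 upX).
by rewrite -/phi phi_zmod -/(f q) -/(f q') fq subrr.
Qed.

End OrderedInvX.

Theorem proposition3p9 (D : idomainType) (X : set (Spec D)) :
  prufer D -> splitting_set X ->
  [/\ convex_subgroup (InvX X),
      exists f : {additive Quotient.quot (InvX X) -> Inv (Omega X)}, bijective f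
    & X `<=` Max D -> archimedean_lgroup (InvXg X)].
Proof.
move=> prD [upX _]; split; [split | exact: quotient_InvX_iso | exact: InvXg_archimedean].
  exact: InvX_zmod.
by move=> I J L /ltW IJ /ltW JL IX LX; apply: InvX_squeeze IJ JL IX LX.
Qed.
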